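(* Let $M,N\in\mathbb{N}$. Then the following conditions are equivalent: (i) $\mathfrak{S}_{M,N}^{1/2}\neq\varnothing$; (ii) $2N-1\leq M\leq\binom{N+1}{2}$; (iii) $\mathfrak{n}_{-}(M)\leq N\leq\mathfrak{n}_{+}(M)$, where $\mathfrak{n}_{-}(M)=\left\lceil\frac{\sqrt{8M+1}-1}{2}\right\rceil$ and $\mathfrak{n}_{+}(M)=\left\lfloor\frac{M+1}{2}\right\rfloor$. Moreover, the following holds: (a) $\{\mathfrak{n}_{-}(M)\}_{M=1}^\infty$ and $\{\mathfrak{n}_{+}(M)\}_{M=1}^\infty$ are monotonically increasing (i.e. nondecreasing) sequences; (b) for each $k\in\mathbb{N}$, exactly $k$ terms of $\{\mathfrak{n}_{-}(M)\}_{M=1}^\infty$ are equal to $k$; (c) for each $k\in\mathbb{N}$, exactly $2$ terms of $\{\mathfrak{n}_{+}(M)\}_{M=1}^\infty$ are equal to $k$.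
   Context: $\mathbb{N}=\{1,2,3,\ldots\}$ and $\mathbb{R}_+=[0,\infty)$. A sequence $\{a_n\}_{n=0}^\infty\subseteq\mathbb{R}_+$ is a Stieltjes moment sequence if there is a positive Borel measure $\mu$ on $\mathbb{R}_+$ with $a_n=\int_{\mathbb{R}_+}x^n\,d\mu(x)$ for all integers $n\geq 0$ (with $x^0=1$); such $\mu$ is called a representing measure. $\operatorname{supp}$ denotes the closed support. For $M\in\mathbb{N}$, $\mathfrak{S}_M$ is the set of all Stieltjes moment sequences having a representing measure $\mu$ such that $\operatorname{supp}\mu\subseteq(0,\infty)$ and $\operatorname{supp}\mu$ has exactly $M$ elements. For $M,N\in\mathbb{N}$, $\mathfrak{S}_{M,N}^{1/2}$ is the set of all $\{a_n\}_{n=0}^\infty\in\mathfrak{S}_M$ such that $\{\sqrt{a_n}\}_{n=0}^\infty\in\mathfrak{S}_N$. *)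

(* Defs.v *)
From mathcomp Require Import all_boot all_order all_algebra.
From mathcomp Require Import all_classical all_reals all_analysis.
Set Implicit Arguments.
Unset Strict Implicit.
Unset Printing Implicit Defensive.
Import Order.TTheory GRing.Theory Num.Theory.
Import numFieldNormedType.Exports.

Local Open Scope classical_set_scope.
Local Open Scope ring_scope.

(* A positive Borel measure on [0, +oo[ is encoded as a Borel measure on the
   line that vanishes on ]-oo, 0[ (its extension by zero). *)
Definition representing_measure (R : realType)
    (mu : {measure set (measurableTypeR R) -> \bar R}) (a : nat -> R) : Prop :=
  mu (`]-oo, 0%R[ : set R)%classic = 0%E /\
  forall n : nat, (\int[mu]_(x in `[0%R, +oo[) (x ^+ n)%:E)%E = (a n)%:E.

Definition stieltjes (R : realType) (a : nat -> R) : Prop :=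
  (forall n : nat, 0 <= a n) /\
  exists mu : {measure set (measurableTypeR R) -> \bar R},
    representing_measure mu a.

Definition closed_support (R : realType)
    (mu : {measure set (measurableTypeR R) -> \bar R}) : set R :=
  [set x : R | forall U : set R, open U -> U x -> (0 < mu U)%E].

Definition stieltjes_card (R : realType) (M : nat) : set (nat -> R) :=
  [set a : nat -> R | stieltjes a /\
    exists mu : {measure set (measurableTypeR R) -> \bar R},
      [/\ representing_measure mu a,
          closed_support mu `<=` `]0%R, +oo[ &
          (closed_support mu #= `I_M)%card] ].

Definition stieltjes_sqrt_card (R : realType) (M N : nat) : set (nat -> R) :=
  [set a : nat -> R | stieltjes_card M a /\
    stieltjes_card N (fun n : nat => Num.sqrt (a n))].

Definition n_minus (R : realType) (M : nat) : int :=
  Num.ceil ((Num.sqrt (8%:R * M%:R + 1) - 1) / 2%:R : R).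

Definition n_plus (R : realType) (M : nat) : int :=
  Num.floor ((M%:R + 1) / 2%:R : R).

(* Main.v *)
Require Import Defs.
From mathcomp Require Import all_boot all_order all_algebra.
From mathcomp Require Import all_classical all_reals all_analysis.
From mathcomp Require Import measurable_realfun.
From mathcomp Require Import zify lra.
Import Order.TTheory GRing.Theory Num.Theory.
Import numFieldNormedType.Exports.

(** A sequence lies in the class of M-atomic Stieltjes sequences exactly when
it is a power sum a_n = sum_i p_i y_i^n with positive weights p_i at M
distinct positive nodes y_i.  If the square roots are such a power sum with
node set X, where |X| = N, then squaring gives
a_n = sum_(x, x' in X) q_x q_x' (x x')^n.
The weights are positive, so nothing cancels, and since power sums determine
their nodes, the support of the measure representing a is the product set
X X = {x x' | x, x' in X}.  Hence condition (i) asks which numbers M are of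
the form |X X| for an N-element set X of positive reals, a question about
product sets alone.

There are at most as many products as unordered pairs with repetition, that is
'C(N+1, 2).  There are at least 2N - 1, because with x_1 < ... < x_N the chain
x_1 x_1 < x_1 x_2 < ... < x_1 x_N < x_2 x_N < ... < x_N x_N has that length;
both bounds are in [size_pairset_mul_bounds].  Every intermediate value occurs
([exists_sumset_size]): taking X to be a set of powers of 2 turns products into
sums of natural numbers, and sumsets of size M are built by induction on N.
Either a very large element is added to a smaller set, which increases the
sumset by the maximal amount, or, for the small values of M, an interval
{0, ..., N-2} is completed by a single point at a suitable distance.

The passage between measures and power sums is [stieltjes_cardE] and
[stieltjes_card_power_sum].  It rests on the fact that the complement of the
closed support is a null set, being a countable union of null intervals with
rational endpoints; a measure with finite support is thus carried by its atoms.

Finally n_minus and n_plus are the lower adjoint of N |-> 'C(N+1, 2) and the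
upper adjoint of N |-> 2N - 1: n_minus M <= N iff M <= 'C(N+1, 2), and
N <= n_plus M iff 2N - 1 <= M ([n_minus_le], [le_n_plus]).  The level sets in
(b) and (c) are therefore the intervals between consecutive values of these
two functions. *)

Set Implicit Arguments.
Unset Strict Implicit.
Unset Printing Implicit Defensive.

Local Open Scope classical_set_scope.
Local Open Scope ring_scope.

(** * Sizes of sumsets and product sets *)

(** One definition serves both sumsets of natural numbers and product sets of
reals, so that the exponential can transport the former to the latter; the list
may have repetitions, and cardinalities are taken after [undup]. *)
Definition pairset {T : Type} (op : T -> T -> T) (A : seq T) : seq T :=
  [seq op x y | x <- A, y <- A].

Lemma eq_size_undup {T : eqType} (s t : seq T) :
  s =i t -> size (undup s) = size (undup t).
Proof. by move=> st; apply/perm_size/perm_undup. Qed.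

Lemma mem_pairset_cons {T : eqType} (op : T -> T -> T) (x : T) (A : seq T) :
  commutative op ->
  pairset op (x :: A) =i [seq op x y | y <- x :: A] ++ pairset op A.
Proof.
move=> opC z; rewrite mem_cat; apply/allpairsP/orP.
  case=> -[u v] []; rewrite [(u, v).1]/= [(u, v).2]/= => uA vA ->.
  have [->|ux] := eqVneq u x; first by left; exact: (map_f (op x)).
  have [vx|vx] := eqVneq v x; first by
    left; rewrite vx opC; exact: (map_f (op x)).
  move: uA vA; rewrite !inE (negPf ux) (negPf vx) /= => uA vA.
  by right; apply: allpairs_f.
move=> [/mapP[y yA ->]|/allpairsP[[u v] /= [uA vA ->]]].
  by exists (x, y); split=> //=; rewrite mem_head.
by exists (u, v); split=> //=; rewrite inE ?uA ?vA orbT.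
Qed.

(** Induction on A: a new element x contributes only the products of x with the
elements of x :: A, which is the increment in Pascal's rule. *)
Lemma size_pairset_le {T : eqType} (op : T -> T -> T) (A : seq T) :
  commutative op -> (size (undup (pairset op A)) <= 'C((size A).+1, 2))%N.
Proof.
move=> opC; elim: A => [//|x A IH].
rewrite (eq_size_undup (mem_pairset_cons x A opC)) undup_cat size_cat binS bin1.
rewrite addnC leq_add //.
rewrite (leq_trans (size_subseq (filter_subseq _ _))) //.
by rewrite (leq_trans (size_undup _)) // size_map.
Qed.

(** Removing the smallest element x from x < y < ... loses at least two
products: x x and x y are both smaller than y y, the least product of what
remains. *)
Lemma size_pairset_mul_ge {R : realDomainType} (A : seq R) :
  sorted <%R A -> {in A, forall x, 0 < x} ->
  (2 * size A - 1 <= size (undup (pairset *%R A)))%N.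
Proof.
elim: A => [//|x [|y A] IH] /=; first by [].
move=> /andP[xy yA] pos.
have x0 : 0 < x by apply: pos; rewrite mem_head.
have y0 : 0 < y by apply: pos; rewrite !inE eqxx orbT.
have pos' : {in y :: A, forall z, 0 < z}.
  by move=> z zA; apply: pos; rewrite inE zA orbT.
have {}IH := IH yA pos'.
set B := y :: A in IH yA pos' *.
have yB z : z \in B -> y <= z.
  rewrite inE => /orP[/eqP->//|zA].
  by have /allP/(_ z zA)/ltW := order_path_min lt_trans yA.
have low z : z \in pairset *%R B -> x * y < z.
  move=> /allpairsP[[u v] /= [/yB yu /yB yv ->]].
  by rewrite (lt_le_trans (y := y * y)) ?ltr_pM2r// ler_pM// ltW.
have xx : x * x < x * y by rewrite ltr_pM2l.
change (2 * (size B).+1 - 1 <= size (undup (pairset *%R (x :: B))))%N.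
have B0 : (0 < size B)%N by [].
have yB' : y \in B by rewrite mem_head.
clearbody B.
(* Truncated subtraction: the equation uses that B is nonempty. *)
have -> : (2 * (size B).+1 - 1 = (2 * size B - 1).+2)%N by lia.
apply: (@leq_trans (size [:: x * x, x * y & undup (pairset *%R B)])) => //.
apply: uniq_leq_size.
  rewrite !cons_uniq in_cons !mem_undup undup_uniq andbT negb_or (lt_eqF xx) /=.
  by apply/andP; split; apply/negP => /low; rewrite ?ltxx// ltNge ltW.
move=> z; rewrite !in_cons !mem_undup mem_pairset_cons; last exact: mulrC.
rewrite mem_cat => /or3P[/eqP->|/eqP->|->]; last by rewrite orbT.
- by rewrite (map_f ( *%R x)) // mem_head.
- by rewrite (map_f ( *%R x)) // in_cons yB' orbT.
Qed.

Lemma pairset_map {T U : Type} (opT : T -> T -> T) (opU : U -> U -> U)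
    (f : T -> U) (A : seq T) :
  {morph f : x y / opT x y >-> opU x y} ->
  pairset opU (map f A) = map f (pairset opT A).
Proof.
move=> fM; rewrite /pairset allpairs_mapl allpairs_mapr map_allpairs.
by apply: eq_allpairs => x y /=; rewrite fM.
Qed.

(** Beyond twice every element of A, the sums involving b exceed all sums
inside A, so the increment is the largest possible one. *)
Lemma size_sumset_extend (A : seq nat) (b : nat) :
  uniq A -> {in A, forall a, 2 * a < b}%N ->
  size (undup (pairset addn (b :: A)))
    = ((size A).+1 + size (undup (pairset addn A)))%N.
Proof.
move=> uA Ab.
rewrite (eq_size_undup (mem_pairset_cons b A addnC)) undup_cat size_cat.
congr (_ + _)%N; rewrite undup_id ?(map_inj_uniq (@addnI b)); last first.
  by rewrite /= uA andbT; apply/negP => /Ab; lia.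
rewrite (_ : seq.filter _ _ = [seq (b + y)%N | y <- b :: A]) ?size_map //.
apply/all_filterP/allP => z /mapP[y _ ->].
by apply/negP => /allpairsP[[u v] /= [/Ab + /Ab + E]]; lia.
Qed.

(** The elements are 0, ..., n-1 and n-1+k.  The interval sums to [0, 2n-2], its
translate by n-1+k is [n-1+k, 2n-2+k], and k <= n leaves no gap between the two;
the double of the isolated point lies beyond because k > 0. *)
Lemma size_sumset_interval_gap (n k : nat) : (0 < k <= n)%N -> (0 < n)%N ->
  size (undup (pairset addn ((n.-1 + k) :: iota 0 n))) = (2 * n + k)%N.
Proof.
move=> kn n0.
pose t := ((2 * (n.-1 + k)) :: iota 0 (2 * n - 1 + k))%N.
have <- : size t = (2 * n + k)%N by rewrite /= size_iota; lia.
rewrite -[in RHS](@undup_id _ t); last by rewrite /= iota_uniq mem_iota; lia.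
apply: eq_size_undup => z; rewrite (mem_pairset_cons _ _ addnC) mem_cat.
rewrite /t map_cons !inE mul2n -addnn -orbA; congr (_ || _).
rewrite mem_iota /=; apply/idP/idP.
  case/orP=> [/mapP[y]|/allpairsP[[u v] /= []]]; rewrite !mem_iota.
    by move=> yn ->; lia.
  by move=> un vn ->; lia.
move=> zl; apply/orP.
have [zs|zs] := ltnP z (2 * n - 1)%N.
  (* A sum z <= 2(n-1) splits with the first term as large as possible. *)
  right; apply/allpairsP; exists (minn z n.-1, z - minn z n.-1)%N => /=.
  by rewrite !mem_iota; split; lia.
left; apply/mapP; exists (z - (n.-1 + k))%N; last by lia.
by rewrite mem_iota; lia.
Qed.

(** In passing from n+1 to n+2 elements the admissible range is [2n+3, 'C(n+3,
2)]. Its part up to 3(n+1) is reached by intervals with one isolated point, and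
the part above 3(n+1) by adding a large element to a set of n+1 elements, which
raises the admissible range for n+1 by n+2. *)
Lemma exists_sumset_size (N M : nat) :
  (0 < N)%N -> (2 * N - 1 <= M <= 'C(N.+1, 2))%N ->
  exists A : seq nat,
    [/\ uniq A, size A = N & size (undup (pairset addn A)) = M].
Proof.
elim: N M => [//|[|n] IH] M _ HM.
  by exists [:: 0%N]; split=> //=; move: HM; rewrite binn; lia.
move: HM; rewrite binS bin1 => HM.
have [Mle|Mgt] := leqP M (3 * n.+1)%N.
  exists ((n + (M - 2 * n.+1)) :: iota 0 n.+1)%N; split.
  - by rewrite cons_uniq iota_uniq mem_iota; lia.
  - by rewrite /= size_iota.
  - by rewrite (@size_sumset_interval_gap n.+1) //; lia.
have [//||A [uA sA cA]] := IH (M - n.+2)%N; first by lia.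
(* Any number above twice every element will do. *)
pose b := (2 * \sum_(a <- A) a).+1.
have Ab : {in A, forall a, 2 * a < b}%N.
  by move=> a aA; rewrite ltnS leq_mul2l /= (big_rem a) //= leq_addr.
exists (b :: A); split.
- by rewrite /= uA andbT; apply/negP => /Ab; lia.
- by rewrite /= sA.
- by rewrite size_sumset_extend // sA cA; lia.
Qed.

Lemma size_pairset_mul_bounds {R : realDomainType} (X : seq R) :
  uniq X -> {in X, forall x, 0 < x} ->
  (2 * size X - 1 <= size (undup (pairset *%R X)) <= 'C((size X).+1, 2))%N.
Proof.
move=> uX X0; rewrite size_pairset_le ?andbT; last exact: mulrC.
have sXE := mem_sort <=%R X.
rewrite -(size_sort <=%R X) -(eq_size_undup (mem_allpairs *%R sXE sXE)).
apply: size_pairset_mul_ge; first by rewrite sort_lt_sorted.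
by move=> x; rewrite sXE => /X0.
Qed.

(** * Power sums with positive weights *)

(** A positive measure with finitely many atoms is represented by the list of
its pairs (weight, node); nodes may repeat, which keeps the square of a list
simple. *)
Definition power_sum {R : pzRingType} (s : seq (R * R)) (n : nat) : R :=
  \sum_(u <- s) u.1 * u.2 ^+ n.

Definition nodes {R : Type} (s : seq (R * R)) : seq R := [seq u.2 | u <- s].

(** Equality of all power sums is linear in the monomials, hence extends to
every polynomial. *)
Lemma power_sum_horner {R : comNzRingType} (s t : seq (R * R)) (p : {poly R}) :
  power_sum s =1 power_sum t ->
  \sum_(u <- s) u.1 * p.[u.2] = \sum_(u <- t) u.1 * p.[u.2].
Proof.
move=> st.
have E r : \sum_(u <- r) u.1 * p.[u.2] = \sum_(i < size p) p`_i * power_sum r i.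
  under eq_bigr do rewrite horner_coef mulr_sumr.
  rewrite exchange_big /=; apply: eq_bigr => i _.
  by rewrite mulr_sumr; apply: eq_bigr => u _; rewrite mulrCA.
by rewrite !E; apply: eq_bigr => i _; rewrite st.
Qed.

(** If w were a node of s only, test against the polynomial vanishing at all
nodes of t and at all nodes of s but w: the t-side is zero, while the s-side is
a nonzero value times the total weight at w, which is positive. *)
Lemma power_sum_nodes_sub {R : realDomainType} (s t : seq (R * R)) :
  {in s, forall u, 0 < u.1} -> power_sum s =1 power_sum t ->
  {subset nodes s <= nodes t}.
Proof.
move=> s0 st w /mapP[u0 u0s wE]; apply/negPn/negP => wt.
pose P := \prod_(z <- nodes t) ('X - z%:P).
pose Q := \prod_(z <- nodes s | z != w) ('X - z%:P).
have := power_sum_horner (P * Q) st.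
rewrite [RHS]big_seq [RHS]big1 => [|u ut]; last first.
  suff /rootP -> : root (P * Q) u.2 by rewrite mulr0.
  by rewrite rootM root_prod_XsubC (map_f snd ut).
have PQw : (P * Q).[w] != 0.
  rewrite -rootE rootM negb_or root_prod_XsubC wt /=.
  rewrite /Q -big_filter root_prod_XsubC mem_filter eqxx /=; exact: isT.
rewrite (bigID (fun u => u.2 == w)) /=.
rewrite [X in _ + X]big_seq_cond [X in _ + X]big1.
  rewrite addr0 (eq_bigr (fun u => u.1 * (P * Q).[w])); last first.
    by move=> u /eqP ->.
  rewrite -mulr_suml => /eqP; rewrite mulf_eq0 (negPf PQw) orbF => /eqP E.
  suff : 0 < \sum_(u <- s | u.2 == w) u.1 by rewrite E ltxx.
  rewrite (big_rem u0) //= wE eqxx ltr_wpDr // ?s0 //.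
  rewrite big_seq_cond; apply: sumr_ge0 => u /andP[/mem_rem us _].
  by rewrite ltW // s0.
move=> u /andP[us uw]; suff /rootP -> : root (P * Q) u.2 by rewrite mulr0.
rewrite rootM; apply/orP; right.
by rewrite /Q -big_filter root_prod_XsubC mem_filter uw (map_f snd us).
Qed.

Lemma power_sum_nodes {R : realDomainType} (s t : seq (R * R)) :
  {in s, forall u, 0 < u.1} -> {in t, forall u, 0 < u.1} ->
  power_sum s =1 power_sum t -> nodes s =i nodes t.
Proof.
move=> s0 t0 st w; apply/idP/idP; first exact: power_sum_nodes_sub.
by apply: power_sum_nodes_sub => // n; rewrite st.
Qed.

(** The list of the convolution square: its power sums are the squares of those
of s, and its nodes are the pairwise products. *)
Definition square {R : pzRingType} (s : seq (R * R)) : seq (R * R) :=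
  pairset (fun u v => (u.1 * v.1, u.2 * v.2)) s.

Lemma nodes_square {R : pzRingType} (s : seq (R * R)) :
  nodes (square s) = pairset *%R (nodes s).
Proof. by apply/esym/pairset_map. Qed.

Lemma square_gt0 {R : realDomainType} (s : seq (R * R)) :
  {in s, forall u, 0 < u.1 /\ 0 < u.2} ->
  {in square s, forall u, 0 < u.1 /\ 0 < u.2}.
Proof.
move=> s0 _ /allpairsP[[u v] /= [/s0[u1 u2] /s0[v1 v2] ->]] /=.
by rewrite !mulr_gt0.
Qed.

Lemma power_sum_square {R : comPzRingType} (s : seq (R * R)) (n : nat) :
  power_sum (square s) n = power_sum s n ^+ 2.
Proof.
rewrite /power_sum big_allpairs_dep expr2 mulr_suml; apply: eq_bigr => u _.
by rewrite mulr_sumr; apply: eq_bigr => v _ /=; rewrite exprMn mulrACA.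
Qed.

(** * Measures with finite support *)

(** A point off the support has a null neighbourhood, which contains a null
interval with rational endpoints around the point, and there are only countably
many of those. They are indexed through [unpickle] to obtain a sequence. *)
Lemma negligible_setC_support {R : realType}
    (mu : {measure set (measurableTypeR R) -> \bar R}) :
  mu.-negligible (~` closed_support mu).
Proof.
pose F (q : rat * rat) : set R := `]ratr q.1, ratr q.2[%classic.
pose G k : set R := if unpickle k is Some q
  then if mu (F q) == 0%E then F q else set0 else set0.
suff /negligibleS : mu.-negligible (\bigcup_k G k).
  apply.
  move=> x /existsNP[U /not_implyP[oU /not_implyP[Ux /negP]]].
  rewrite lt0e measure_ge0 andbT negbK => /eqP mU.
  have /nbhs_ballP[e /= e0 eU] : nbhs x U by exact: open_nbhs_nbhs.
  have [p] := @rat_in_itvoo R (x - e) x ltac:(by rewrite ltrBlDr ltrDl).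
  rewrite in_itv /= => /andP[p1 p2].
  have [q] := @rat_in_itvoo R x (x + e) ltac:(by rewrite ltrDl).
  rewrite in_itv /= => /andP[q1 q2].
  have mF : mu (F (p, q)) == 0%E.
    apply/eqP; apply: (@subset_measure0 _ _ _ mu _ U) => //.
    - exact: measurable_itv.
    - exact: open_measurable.
    - move=> y; rewrite /F /= in_itv /= => /andP[y1 y2]; apply: eU.
      by rewrite /ball /= ltr_norml; lra.
  exists (pickle (p, q)); first exact: I.
  by rewrite /G pickleK mF /F /= in_itv /= p2 q1.
apply: negligible_bigcup => k; rewrite /G; case: unpickle => [q|].
  case: eqP => [q0|_]; last exact: negligible_set0.
  by apply/negligibleP => //; exact: measurable_itv.
exact: negligible_set0.
Qed.

Lemma set_seq_bigsetU (T : eqType) (s : seq T) :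
  [set` s] = \big[setU/set0]_(y <- s) [set y].
Proof.
elim: s => [|y s IH]; first by rewrite big_nil set_nil.
rewrite big_cons -IH; apply/seteqP; split=> x /=; rewrite in_cons.
  by case/predU1P; [left|right].
by case=> [->|->]; rewrite ?eqxx ?orbT.
Qed.

Lemma measurable_set_seq {R : realType} (s : seq R) :
  measurable ([set` s] : set (measurableTypeR R)).
Proof.
rewrite set_seq_bigsetU; apply: bigsetU_measurable => y _.
exact: measurable_set1.
Qed.

Lemma closed_set_seq {R : realType} (s : seq R) : closed [set` s].
Proof.
have /accessible_finite_set_closed : accessible_space R.
  exact/hausdorff_accessible/Rhausdorff.
by apply; apply/finite_seqP; exists s.
Qed.

(** In a finite support each point is isolated: the complement of the other
points is an open neighbourhood, whose mass is that of y alone since everything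
off the support is null. *)
Lemma support_atom_gt0 {R : realType}
    (mu : {measure set (measurableTypeR R) -> \bar R}) (s : seq R) (y : R) :
  closed_support mu = [set` s] -> y \in s -> (0 < mu [set y])%E.
Proof.
move=> sE ys; pose U := ~` [set` seq.filter (predC1 y) s] : set R.
have oU : open U by apply: closed_openC; exact: closed_set_seq.
have Uy : U y by rewrite /U /= mem_filter /= eqxx.
have /(_ U oU Uy) : closed_support mu y by rewrite sE.
have mC : measurable (~` [set` s] : set (measurableTypeR R)).
  by apply: measurableC; exact: measurable_set_seq.
have C0 : mu (~` [set` s]) = 0%E.
  by apply/negligibleP => //; rewrite -sE; exact: negligible_setC_support.
move=> /lt_le_trans; apply.
rewrite -(@measureU0 _ _ _ mu [set y] (~` [set` s])) //.
apply: le_measure; rewrite ?inE.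
- exact: open_measurable.
- by apply: measurableU => //; exact: measurable_set1.
- move=> x; rewrite /U /= mem_filter /= => /negP; rewrite negb_and negbK.
  by case/orP => [/eqP|/negP]; [left|right].
Qed.

(** Off the support everything is null, and the support is a disjoint union of
singletons. *)
Lemma integral_finite_support {R : realType}
    (mu : {measure set (measurableTypeR R) -> \bar R}) (s : seq R)
    (f : R -> \bar R) :
  uniq s -> closed_support mu = [set` s] -> [set` s] `<=` `[0%R, +oo[%classic ->
  measurable_fun (`[0%R, +oo[%classic : set (measurableTypeR R)) f ->
  (forall x, 0 <= x -> (0 <= f x)%E) ->
  (\int[mu]_(x in `[0%R, +oo[) f x = \sum_(y <- s) (f y * mu [set y]))%E.
Proof.
move=> us sE s0 mf f0; pose D : set (measurableTypeR R) := `[0%R, +oo[%classic.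
have mD : measurable D by exact: measurable_itv.
have mC : measurable (~` [set` s] : set (measurableTypeR R)).
  by apply: measurableC; exact: measurable_set_seq.
have C0 : mu (~` [set` s]) = 0%E.
  by apply/negligibleP => //; rewrite -sE; exact: negligible_setC_support.
have f0' x : D x -> (0 <= f x)%E by rewrite /D /= in_itv /= andbT => /f0.
rewrite (ge0_negligible_integral mC mD mf f0' C0) setDE setCK setIC.
rewrite (setIidl s0) set_seq_bigsetU ge0_integral_bigsetU //.
- apply: eq_bigr => y _.
  rewrite -(@integral_cst _ _ _ mu [set y]); last exact: measurable_set1.
  by apply: eq_integral => x; rewrite inE => ->.
- by move=> x y _ _ [z [/= <- <-]].
- by rewrite -set_seq_bigsetU; exact: (measurable_funS mD s0 mf).
- by move=> x; rewrite -set_seq_bigsetU => /s0 /f0'.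
Qed.

Lemma card_set_seq (T : choiceType) (s : seq T) (M : nat) :
  ([set` s] #= `I_M)%card <-> size (undup s) = M.
Proof.
have H : ([set` s] #= `I_(size (undup s)))%card.
  case: s => [|x0 s]; first by rewrite set_nil /= II0.
  move: (x0 :: s) => t.
  rewrite (_ : [set` t] = nth x0 (undup t) @` `I_(size (undup t))).
    apply: inj_card_eq => i j; rewrite !inE /= => it jt /eqP.
    by rewrite nth_uniq ?undup_uniq // => /eqP.
  apply/seteqP; split => [x /= xt|_ [i /= it <-]].
    exists (index x (undup t)) => /=; first by rewrite index_mem mem_undup.
    by rewrite nth_index // mem_undup.
  by rewrite /= -mem_undup mem_nth.
split=> [H'|<- //]; apply/card_eq_II.
by apply: card_eq_trans H'; rewrite card_eq_sym.
Qed.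

Lemma measurable_expr_EFin {R : realType} (n : nat)
    (D : set (measurableTypeR R)) :
  measurable_fun D (fun x : R => (x ^+ n)%:E).
Proof. exact/measurable_EFinP/measurable_funX/measurable_id. Qed.

(** The weights are the masses of the atoms; they are finite because the zeroth
moment bounds the mass of the half-line. *)
Lemma stieltjes_cardE {R : realType} (M : nat) (a : nat -> R) :
  stieltjes_card M a ->
  exists s : seq (R * R),
    [/\ uniq (nodes s), size s = M, {in s, forall u, 0 < u.1 /\ 0 < u.2} &
        a =1 power_sum s].
Proof.
move=> [[a0 _] [mu [[_ amu] supp0 suppM]]].
have /finite_seqP[s0 s0E] : finite_set (closed_support mu).
  by apply/finite_setP; exists M.
pose s := undup s0.
have sE : closed_support mu = [set` s].
  by rewrite s0E; apply/seteqP; split=> x /=; rewrite mem_undup.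
have us : uniq s by exact: undup_uniq.
have spos y : y \in s -> 0 < y.
  by move=> ys; have := supp0 y; rewrite sE /= in_itv /= andbT; apply.
have sub : [set` s] `<=` `[0%R, +oo[%classic.
  by move=> y /= /spos /ltW; rewrite in_itv /= andbT.
have fin y : y \in s -> mu [set y] \is a fin_num.
  move=> ys; rewrite ge0_fin_numE //.
  apply: (@le_lt_trans _ _ (mu (`[0%R, +oo[%classic : set R))).
    apply: le_measure; rewrite ?inE.
    - exact: measurable_set1.
    - exact: measurable_itv.
    - by move=> _ ->; exact: sub.
  have := amu 0%N; rewrite (eq_integral (cst 1%E)) //.
  rewrite integral_cst ?mul1e; last exact: measurable_itv.
  by move=> ->; rewrite ltry.
exists [seq (fine (mu [set y]), y) | y <- s]; split.
- by rewrite /nodes -map_comp map_id.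
- rewrite size_map; apply/card_set_seq; rewrite -s0E //.
- move=> _ /mapP[y ys ->] /=; split; last exact: spos.
  by rewrite fine_gt0 // (support_atom_gt0 sE ys) ltey_eq fin.
- move=> n; apply: EFin_inj; rewrite -amu (integral_finite_support us sE sub).
  + rewrite /power_sum big_map -sumEFin big_seq [RHS]big_seq.
    by apply: eq_bigr => y ys; rewrite /= EFinM fineK ?fin // muleC.
  + exact: measurable_expr_EFin.
  + by move=> x x0; rewrite lee_fin exprn_ge0.
Qed.

(** The weights enter through their absolute values, which are nonnegative by
construction and leave positive weights unchanged. *)
Definition atomic_measure {R : realType} (s : seq (R * R)) :
    {measure set (measurableTypeR R) -> \bar R} :=
  msum (fun i => mscale (`|(nth (0, 0) s i).1|%:nng)
                        (\d_((nth (0, 0) s i).2 : measurableTypeR R)))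
       (size s).

Lemma atomic_measureE {R : realType} (s : seq (R * R)) (A : set R) :
  atomic_measure s A = (\sum_(u <- s) (`|u.1| * (u.2 \in A)%:R)%:E)%E.
Proof. by rewrite (big_nth (0, 0)) big_mkord. Qed.

Lemma atomic_measure_gt0 {R : realType} (s : seq (R * R)) (A : set R) :
  {in s, forall u, 0 < u.1} ->
  (0 < atomic_measure s A)%E <-> exists2 y, y \in nodes s & A y.
Proof.
move=> s0; rewrite atomic_measureE sumEFin lte_fin.
split=> [|[y /mapP[u us ->] Au]].
  move=> lt0; apply: contrapT => nA; move: lt0; rewrite big_seq big1 ?ltxx //.
  move=> u us; case: (boolP (u.2 \in A)) => [|_]; last by rewrite mulr0.
  by rewrite inE => Au; case: nA; exists u.2 => //; exact: (map_f snd).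
rewrite (big_rem u) //= ltr_wpDr //.
  by apply: sumr_ge0 => v _; rewrite mulr_ge0.
by rewrite mem_set // mulr1 normr_gt0 gt_eqF // s0.
Qed.

Lemma support_atomic_measure {R : realType} (s : seq (R * R)) :
  {in s, forall u, 0 < u.1} ->
  closed_support (atomic_measure s) = [set` nodes s].
Proof.
move=> s0; apply/seteqP; split=> [x xs|x /= xs U _ Ux]; last first.
  by apply/atomic_measure_gt0 => //; exists x.
apply: contrapT => xns.
have /atomic_measure_gt0[//|y ys] :=
  xs _ (closed_openC (@closed_set_seq R (nodes s))) xns.
by [].
Qed.

Lemma stieltjes_card_power_sum {R : realType} (s : seq (R * R)) :
  {in s, forall u, 0 < u.1 /\ 0 < u.2} ->
  stieltjes_card (size (undup (nodes s))) (power_sum s).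
Proof.
move=> s0.
have s1 : {in s, forall u, 0 < u.1} by move=> u /s0[].
have rep : representing_measure (atomic_measure s) (power_sum s).
  split.
    apply/eqP; rewrite eq_le measure_ge0 andbT leNgt; apply/negP.
    move=> /atomic_measure_gt0[//|y /mapP[u /s0[_ u0] ->]].
    by rewrite /= in_itv /= ltNge ltW.
  move=> n; have f0 (x : R) : `[0%R, +oo[%classic x -> (0 <= (x ^+ n)%:E)%E.
    by rewrite /= in_itv /= andbT lee_fin => /exprn_ge0.
  have mD : measurable (`[0%R, +oo[%classic : set (measurableTypeR R)).
    exact: measurable_itv.
  rewrite ge0_integral_measure_sum //; last exact: measurable_expr_EFin.
  rewrite /power_sum (big_nth (0, 0)) big_mkord -sumEFin; apply: eq_bigr => i _.
  rewrite ge0_integral_mscale //; last exact: measurable_expr_EFin.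
  rewrite integral_dirac //; last exact: measurable_expr_EFin.
  have [u1 u2] := s0 _ (mem_nth (0, 0) (ltn_ord i)).
  rewrite diracE mem_set /= ?in_itv /= ?(ltW u2) // mul1e EFinM.
  by rewrite gtr0_norm.
split.
  split; last by exists (atomic_measure s).
  move=> n; rewrite /power_sum big_seq; apply: sumr_ge0 => u /s0[u1 u2].
  by rewrite mulr_ge0 ?exprn_ge0 // ltW.
exists (atomic_measure s); rewrite support_atomic_measure //; split=> //.
  by move=> x /= /mapP[u /s0[_ u2] ->]; rewrite in_itv /= andbT.
exact/card_set_seq.
Qed.

(** * The square root problem *)

(** Squaring the power sum of the square roots gives a second representation of
a, so its nodes must be those of a: M is the size of a product set of N
positive reals. *)
Lemma stieltjes_sqrt_card_bounds (R : realType) (M N : nat) (a : nat -> R) :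
  stieltjes_sqrt_card M N a -> (2 * N - 1 <= M <= 'C(N.+1, 2))%N.
Proof.
move=> [aM bN].
have a0 n : 0 <= a n by have [[]] := aM.
have [s [us <- s0 aE]] := stieltjes_cardE aM.
have [t [ut <- t0 bE]] := stieltjes_cardE bN.
have st : nodes s =i pairset *%R (nodes t).
  move=> w; rewrite -nodes_square.
  apply: power_sum_nodes; first by move=> u /s0[].
    by move=> u /(square_gt0 t0)[].
  by move=> n; rewrite power_sum_square -aE -bE sqr_sqrtr.
have <- : size (undup (pairset *%R (nodes t))) = size s.
  by rewrite -(eq_size_undup st) undup_id // size_map.
rewrite -(size_map snd t); apply: size_pairset_mul_bounds => //.
by move=> x /mapP[u /t0[_ u2] ->].
Qed.

(** The powers 2^k, k in A, have as many products as A has sums; unit weights at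
these nodes give the square roots, and the squared list gives a. *)
Lemma stieltjes_sqrt_card_exists (R : realType) (M N : nat) :
  (0 < N)%N -> (2 * N - 1 <= M <= 'C(N.+1, 2))%N ->
  @stieltjes_sqrt_card R M N !=set0.
Proof.
move=> N0 /(exists_sumset_size N0)[A [uA <- <-]].
pose f (k : nat) : R := 2 ^+ k.
have fI : injective f by apply: ieexprIn => //; rewrite gt_eqF // ltr1n.
pose t : seq (R * R) := [seq (1, f k) | k <- A].
have tE : nodes t = [seq f k | k <- A] by rewrite /nodes -map_comp.
have t0 : {in t, forall u, 0 < u.1 /\ 0 < u.2}.
  by move=> _ /mapP[k _ ->]; split; rewrite ?exprn_gt0.
exists (power_sum (square t)); split.
  have := stieltjes_card_power_sum (square_gt0 t0).
  rewrite nodes_square tE (pairset_map _ (exprD 2)).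
  by rewrite (undup_map_inj fI) size_map.
have := stieltjes_card_power_sum t0.
rewrite tE undup_id ?map_inj_uniq // size_map.
rewrite (_ : power_sum t = fun n => Num.sqrt (power_sum (square t) n)) //.
apply/funext => n; rewrite power_sum_square sqrtr_sqr ger0_norm //.
rewrite /power_sum big_seq; apply: sumr_ge0 => u /t0[u1 u2].
by rewrite mulr_ge0 ?exprn_ge0 // ltW.
Qed.

(** * The functions n_minus and n_plus *)

(** Clearing the ceiling, the quotient and the square root turns the left side
into 8M + 1 <= (2N + 1)^2, that is 2M <= N(N + 1). *)
Lemma n_minus_le (R : realType) (M N : nat) :
  (n_minus R M <= N%:Z) = (M <= 'C(N.+1, 2))%N.
Proof.
rewrite /n_minus ceil_le_int.
have -> : (N%:Z)%:~R = N%:R :> R by [].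
rewrite ler_pdivrMr // lerBlDr -(ler_sqr (x := Num.sqrt _)); last 2 first.
- by rewrite nnegrE sqrtr_ge0.
- by rewrite nnegrE addr_ge0 // mulr_ge0.
rewrite sqr_sqrtr; last by rewrite addr_ge0 // mulr_ge0.
rewrite -!natrM !natr1 -natrX ler_nat.
have := bin_ffact N.+1 2; rewrite !ffactnS ffactn0 /= => E.
rewrite muln1 (_ : 2`! = 2)%N // in E.
by rewrite expnS expn1; nia.
Qed.

Lemma le_n_plus (R : realType) (M N : nat) :
  (N%:Z <= n_plus R M) = (2 * N - 1 <= M)%N.
Proof.
rewrite /n_plus floor_ge_int.
have -> : (N%:Z)%:~R = N%:R :> R by [].
by rewrite ler_pdivlMr // -natrM natr1 ler_nat; lia.
Qed.

Lemma card_shift (k c : nat) (A : set nat) :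
  (forall M, A M <-> (c <= M < c + k)%N) -> (A #= `I_k)%card.
Proof.
move=> AE; rewrite (_ : A = [set (c + i)%N | i in `I_k]).
  by apply: inj_card_eq => x y _ _ /addnI.
apply/seteqP; split=> [M /AE cM|M [i /= ik <-]]; last by apply/AE; lia.
by exists (M - c)%N => /=; lia.
Qed.

(** By [n_minus_le] the level set is the set of M with 'C(k, 2) < M <= 'C(k+1,
2), of size k by Pascal's rule. *)
Lemma card_n_minus (R : realType) (k : nat) : (0 < k)%N ->
  ([set M : nat | (0 < M)%N /\ n_minus R M = k%:Z] #= `I_k)%card.
Proof.
case: k => // k _; apply: (@card_shift _ ('C(k.+1, 2)).+1) => M /=.
have E : (n_minus R M == k.+1%:Z) =
    (n_minus R M <= k.+1%:Z) && ~~ (n_minus R M <= k%:Z) by lia.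
rewrite !n_minus_le (binS k.+1) bin1 in E.
split=> [[_ /eqP]|H]; first by rewrite E; lia.
by split; [lia | apply/eqP; rewrite E; lia].
Qed.

(** By [le_n_plus] the level set is {2k - 1, 2k}. *)
Lemma card_n_plus (R : realType) (k : nat) : (0 < k)%N ->
  ([set M : nat | (0 < M)%N /\ n_plus R M = k%:Z] #= `I_2)%card.
Proof.
move=> k0; apply: (@card_shift _ (2 * k - 1)%N) => M /=.
have E : (n_plus R M == k%:Z) =
    (k%:Z <= n_plus R M) && ~~ (k.+1%:Z <= n_plus R M) by lia.
rewrite !le_n_plus in E.
split=> [[_ /eqP]|H]; first by rewrite E; lia.
by split; [lia | apply/eqP; rewrite E; lia].
Qed.

Lemma n_minus_mono (R : realType) (M1 M2 : nat) :
  (M1 <= M2)%N -> n_minus R M1 <= n_minus R M2.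
Proof.
move=> M12; apply: le_ceil; rewrite ler_pM2r ?invr_gt0 // lerD2r.
by apply: ler_wsqrtr; rewrite lerD2r ler_pM2l // ler_nat.
Qed.

Lemma n_plus_mono (R : realType) (M1 M2 : nat) :
  (M1 <= M2)%N -> n_plus R M1 <= n_plus R M2.
Proof.
by move=> M12; apply: le_floor; rewrite ler_pM2r ?invr_gt0 // lerD2r ler_nat.
Qed.

Theorem theorem8p1 (R : realType) :
  (forall M N : nat, (0 < M)%N -> (0 < N)%N ->
     (@stieltjes_sqrt_card R M N !=set0 <->
        (2 * N - 1 <= M <= 'C(N + 1, 2))%N) /\
     ((2 * N - 1 <= M <= 'C(N + 1, 2))%N <->
        n_minus R M <= N%:Z <= n_plus R M)) /\
  ((forall M1 M2 : nat, (0 < M1)%N -> (M1 <= M2)%N ->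
      n_minus R M1 <= n_minus R M2) /\
   (forall M1 M2 : nat, (0 < M1)%N -> (M1 <= M2)%N ->
      n_plus R M1 <= n_plus R M2)) /\
  (forall k : nat, (0 < k)%N ->
     ([set M : nat | (0 < M)%N /\ n_minus R M = k%:Z] #= `I_k)%card) /\
  (forall k : nat, (0 < k)%N ->
     ([set M : nat | (0 < M)%N /\ n_plus R M = k%:Z] #= `I_2)%card).
Proof.
split; last split; last split.
- move=> M N _ N0; rewrite addn1 n_minus_le le_n_plus.
  rewrite (andbC (M <= 'C(N.+1, 2))%N).
  split=> //; split=> [[a]|]; first exact: stieltjes_sqrt_card_bounds.
  exact: stieltjes_sqrt_card_exists.
- by split=> M1 M2 _; [exact: n_minus_mono|exact: n_plus_mono].
- exact: card_n_minus.
- exact: card_n_plus.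
Qed.
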